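(* For parameters $(a,b) \in \mathbb{R}^2$ let $L = L_{a,b} : \mathbb{R}^2 \to \mathbb{R}^2$ be the Lozi map $$L(x_1,x_2) = \left( 1 - a|x_1| + x_2,\; b x_1 \right).$$ Let $P \subset \mathbb{R}^2$ be the set of $(a,b)$ satisfying $$0 < b < 1, \qquad 0 < a < \tfrac{4-b}{2}, \qquad a > \tfrac{b+2}{\sqrt{2}}, \qquad b < \tfrac{a^2-1}{2a+1}.$$ For $(a,b) \in P$ let $X$ be the unique saddle-type fixed point of $L_{a,b}$ in $x_1 > 0$, and let $\mathcal{A}_{a,b}$ be the closure of the unstable manifold of $X$ (which is a chaotic attractor of $L_{a,b}$ by a theorem of Misiurewicz). Then $\mathcal{A}_{a,b}$ is continuous in the Hausdorff metric, as a function of $(a,b)$, throughout $P$.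
   Context: Let $d$ be the Euclidean metric on $\mathbb{R}^2$. For $X, Y \subseteq \mathbb{R}^2$ put $d_a(X,Y) = \sup_{x \in X} \inf_{y \in Y} d(x,y)$ and $d_H(X,Y) = \max[d_a(X,Y), d_a(Y,X)]$. Continuity of $\mathcal{A}_{a,b}$ in the Hausdorff metric at $\mu=(a,b) \in P$ means: for all $\varepsilon > 0$ there exists $\delta > 0$ such that $d_H(\mathcal{A}_\mu, \mathcal{A}_\nu) < \varepsilon$ whenever $\nu \in P$ and $|\mu - \nu| < \delta$. Known background fixing the object (Misiurewicz, 1980): for every $(a,b) \in P$ the map $L_{a,b}$ has a unique saddle-type fixed point in $x_1>0$ and the closure of the (global) unstable manifold of this point is a chaotic attractor. Here an attractor of a continuous map $f$ on $\mathbb{R}^2$ is a compact set $\mathcal{A}$ with $f(\mathcal{A})=\mathcal{A}$, containing a dense orbit, and such that for some $r>0$ every $x$ within distance $r$ of $\mathcal{A}$ satisfies $d_a(f^n(x),\mathcal{A}) \to 0$ as $n \to \infty$; it is chaotic if in addition Lyapunov exponents of typical points are positive. *)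

(* Defs.v *)
From HB Require Import structures.
From mathcomp Require Import all_boot all_order all_algebra.
From mathcomp Require Import all_classical all_reals all_analysis.

Set Implicit Arguments.
Unset Strict Implicit.
Unset Printing Implicit Defensive.

Import Order.TTheory GRing.Theory Num.Theory.
Import numFieldNormedType.Exports.

Local Open Scope classical_set_scope.
Local Open Scope ring_scope.

(* The library norm on [R * R] is the max norm: it induces the usual topology
   and notion of differentiability of the plane, but the Euclidean distance
   has to be written out. *)
Definition euclid_dist (R : realType) (x y : R * R) : R :=
  Num.sqrt ((x.1 - y.1) ^+ 2 + (x.2 - y.2) ^+ 2).

Definition asym_dist (R : realType) (X Y : set (R * R)) : \bar R :=
  ereal_sup [set ereal_inf [set (euclid_dist x y)%:E | y in Y] | x in X].

Definition hausdorff_dist (R : realType) (X Y : set (R * R)) : \bar R :=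
  maxe (asym_dist X Y) (asym_dist Y X).

Definition lozi (R : realType) (mu x : R * R) : R * R :=
  (1 - mu.1 * `|x.1| + x.2, mu.2 * x.1).

Definition lozi_params (R : realType) : set (R * R) :=
  [set mu | let: (a, b) := mu in
    [/\ 0 < b < 1,
        0 < a < (4 - b) / 2,
        a > (b + 2) / Num.sqrt 2 &
        b < (a ^+ 2 - 1) / (2 * a + 1)]].

Definition diff_eigenvalue (R : realType) (f : R * R -> R * R) (X : R * R)
    (l : R) : Prop :=
  exists2 v : R * R, v != 0 & 'd f X v = l *: v.

(* In the plane the two multipliers of a saddle are necessarily real, so they
   are given by real eigenvalues of the differential. *)
Definition saddle_fixed_point (R : realType) (f : R * R -> R * R)
    (X : R * R) : Prop :=
  [/\ f X = X,
      differentiable f X &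
      exists ls lu : R,
        [/\ diff_eigenvalue f X ls, diff_eigenvalue f X lu &
            `|ls| < 1 < `|lu|]].

(* The global unstable manifold: the points having a backward orbit that
   converges to [X]. When [f] is bijective (as [lozi (a, b)] is for [b != 0])
   the backward orbit is unique, and this is the set of the [x] with
   f^-n(x) --> X. *)
Definition unstable_manifold (R : realType) (f : R * R -> R * R)
    (X : R * R) : set (R * R) :=
  [set x | exists u : nat -> R * R,
    [/\ u 0%N = x, forall n, f (u n.+1) = u n & u @ \oo --> X]].

(* [get] selects an element of the given set; for [mu] in [lozi_params] that
   set is a singleton. *)
Definition lozi_saddle (R : realType) (mu : R * R) : R * R :=
  get [set X : R * R | saddle_fixed_point (lozi mu) X /\ 0 < X.1].

Definition lozi_attractor (R : realType) (mu : R * R) : set (R * R) :=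
  closure (unstable_manifold (lozi mu) (lozi_saddle mu)).

Definition hausdorff_continuous_at (R : realType) (P : set (R * R))
    (A : R * R -> set (R * R)) (mu : R * R) : Prop :=
  forall e : R, 0 < e ->
    exists2 d : R, 0 < d &
      forall nu : R * R, P nu -> euclid_dist mu nu < d ->
        (hausdorff_dist (A mu) (A nu) < e%:E)%E.

(* Main.v *)
Require Import Defs.
From HB Require Import structures.
From mathcomp Require Import all_boot all_order all_algebra.
From mathcomp Require Import all_classical all_reals all_analysis.
From mathcomp Require Import ring lra.

Set Implicit Arguments.
Unset Strict Implicit.
Unset Printing Implicit Defensive.

Import Order.TTheory GRing.Theory Num.Theory.
Import numFieldNormedType.Exports.

Local Open Scope classical_set_scope.
Local Open Scope ring_scope.

(** Let [L] be the map, [X] its saddle and [W] the unstable manifold of [X].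
    The two halves of the continuity have the same cause: [W] is approximated,
    within [e], by the image under [L^N] of a fixed segment [J] of the unstable
    line of [X], and [N] can be chosen uniformly for all the parameters near a
    given one.  Since [L^N J] is contained in [W] and depends continuously
    on the parameters for each [N], the closures of [W] for two nearby parameters
    are close to each other in both directions.

    The uniform approximation is [unstable_near_arc].  It rests on a triangle
    ([trap]) that contains [W] and is mapped into itself.  Two of its edges lie
    on the lines that carry [J] and the folded part of [L J].  The stable
    line of [X] cuts off a smaller triangle ([core]), whose edges are pieces of
    [W] and of the stable line.  Two facts are needed.

    - An orbit in [trap] enters [core] within a bounded time
      ([backward_orbit_visits_core]).  On the right half plane [L] exchanges the
      two sides of the stable line of [X], and so an orbit that avoids [core]
      stays in the left half plane, where it moves away from the stable line of
      the other fixed point at an exponential rate.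

    - The points of [L^n core] are close to the images of the edges of [core]
      when [n] is large ([core_image_near_arc]).  Indeed, the inverse of [L]
      expands a cone of steep directions by a factor at least [7 / 3], while the
      fold of the inverse cuts a segment into at most two pieces.  The
      [n]-th preimage of a short vertical segment thus contains a segment of
      height at least [(7 / 6)^n] times the initial one, and it must cross the
      boundary of [core].  The images of the unstable edges lie in [L^(n+1) J],
      and those of the stable edge shrink to [X], which is a point of [J].

    A point of [W] has a backward orbit in [trap].  This orbit is in [core] at
    some time between [n] and [n + K], and so the point is close to
    [L^(n+K+1) J]. *)

(** * The two multipliers *)

(** The map is parametrized by [lam] and [sig] such that [a = lam - sig] and
    [b = lam * sig]: the multipliers are [- lam] and [sig] at the saddle, and
    [lam] and [- sig] at the other fixed point.  All the lines of the proof
    then have coefficients that are polynomial in [lam] and [sig].  The reason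
    for each condition is as follows.
    - [lam < 2] is [2 * a + b < 4]: the fixed point in the left half plane
      lies outside the trapping region.
    - [det_small] and [det_trace]: the inverse map preserves a cone of steep
      directions, and expands it by more than 2.
    - [stable_meets_lower]: the stable line of the saddle reaches the lower
      edge of the trapping region before it leaves [x_1 > 0].
    - [fold_past_stable]: the unstable manifold, once folded, crosses that
      line, so that this part of the edge lies in the unstable manifold. *)
Record saddle_multipliers (R : realType) (lam sig : R) : Prop := {
  sig_gt0 : 0 < sig;
  sig_lt : sig < 3 / 10;
  lam_gt : 7 / 5 < lam;
  lam_lt2 : lam < 2;
  det_small : 10 * (lam * sig) <= 3 * (lam - sig);
  det_trace : 1 + lam * sig <= lam - sig;
  stable_meets_lower : sig * (3 - 2 * sig) < lam * (1 - 2 * sig);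
  fold_past_stable : 2 * (lam - sig) < lam ^+ 2 * (lam - 3 * sig) }.

(** [a > (b + 2) / sqrt 2] gives [fold_past_stable], and
    [b < (a ^ 2 - 1) / (2 * a + 1)] gives [stable_meets_lower] and
    [det_small]. *)
Lemma lozi_params_multipliers (R : realType) (a b : R) :
  lozi_params (a, b) ->
  exists lam sig, [/\ saddle_multipliers lam sig, a = lam - sig & b = lam * sig].
Proof.
move=> [/andP[b0 b1] /andP[a0 aub] alb bub].
pose s := Num.sqrt (a ^+ 2 + 4 * b).
have s0 : 0 <= s by exact: sqrtr_ge0.
have s2 : s ^+ 2 = a ^+ 2 + 4 * b by rewrite sqr_sqrtr //; nra.
have q0 : 0 < Num.sqrt 2 :> R by rewrite sqrtr_gt0.
have q2 : Num.sqrt 2 ^+ 2 = 2 :> R by rewrite sqr_sqrtr.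
move: alb; rewrite ltr_pdivrMr // => alb.
move: bub; rewrite ltr_pdivlMr; last by nra.
move=> bub.
have a2 : (b + 2) ^+ 2 < 2 * a ^+ 2.
  have -> : 2 * a ^+ 2 = (a * Num.sqrt 2) ^+ 2 by rewrite exprMn q2 mulrC.
  by rewrite ltr_sqr // nnegrE; nra.
have as_ : a < s by rewrite -(@ltr_sqr _ a s) ?nnegrE; nra.
have [lam Hl] : exists lam, lam = (a + s) / 2 by eexists.
have [sig Hs] : exists sig, sig = (s - a) / 2 by eexists.
have Ea : a = lam - sig by lra.
have Eb : b = lam * sig by nra.
have l0 : a < lam by lra.
have sg0 : 0 < sig by lra.
have a14 : 7 / 5 < a by nra.
have l14 : 7 / 5 < lam by lra.
have l2 : lam < 2.
  have : s < 4 - a by rewrite -ltr_sqr ?nnegrE; nra.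
  lra.
exists lam, sig; split=> //.
clear s s0 s2 as_ Hl Hs alb q0 q2.
have a1b : 1 + b <= a by nra.
have ab : 10 * b <= 3 * a by nra.
split=> //; rewrite -?Ea -?Eb //.
- by nra.
- subst a b. nra.
- subst a b. nra.
Qed.

(** * Trapping region and core triangle *)

Definition slozi (R : realType) (lam sig : R) : R * R -> R * R :=
  lozi (lam - sig, lam * sig).

(** The functions [upper], [lower], [right_of_stable] and [escape] are affine
    forms, scaled so that they have no denominators.  [upper] vanishes on the
    unstable line of the saddle, [right_of_stable] on its stable line, and
    [escape] on the stable line of the other fixed point; each of these three is
    multiplied by an eigenvalue on the half plane of its fixed point.
    [lower] vanishes on the image of the left half of the line [upper = 0]. *)
Definition upper (R : realType) (lam sig : R) (x : R * R) : R :=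
  sig - (1 - sig) * (sig * x.1 + x.2).

Definition lower (R : realType) (lam sig : R) (x : R * R) : R :=
  (1 - sig) * (lam - 2 * sig) * x.2 - lam * sig * ((1 - sig) * x.1 - 1).

Definition right_of_stable (R : realType) (lam : R) (x : R * R) : R :=
  (1 + lam) * (lam * x.1 - x.2) - lam.

Definition escape (R : realType) (lam : R) (x : R * R) : R :=
  (lam - 1) * (x.2 + lam * x.1) + lam.

(** A triangle.  The points with [escape > 0] that stay in the left half plane
    move away from the fixed point there, which is outside [trap] because
    [escape] vanishes at it. *)
Definition trap (R : realType) (lam sig : R) : set (R * R) :=
  [set x | [/\ 0 <= upper lam sig x, 0 <= lower lam sig x
             & 2 - lam <= escape lam x]].

(** The part of [trap] on the right of the stable line of the saddle.  Its edges
    are two pieces of the unstable manifold and one piece of the stable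
    manifold. *)
Definition core (R : realType) (lam sig : R) : set (R * R) :=
  [set x | [/\ 0 <= upper lam sig x, 0 <= lower lam sig x
             & 0 <= right_of_stable lam x]].

(** The segment of the unstable line of the saddle from the point [Z] where the
    unstable manifold first meets the axis [x_2 = 0] ([tau = 0]) to the image
    of [Z] ([tau = 1]). *)
Definition base_arc (R : realType) (lam sig tau : R) : R * R :=
  ((1 - tau * lam) / (1 - sig), tau * (lam * sig) / (1 - sig)).

Lemma upper_lozi_right (R : realType) (lam sig : R) x : 0 <= x.1 ->
  upper lam sig (slozi lam sig x) = sig * upper lam sig x.
Proof. by move=> x0; rewrite /upper /slozi /lozi /= ger0_norm //; ring. Qed.

Lemma upper_lozi_left (R : realType) (lam sig : R) x : x.1 <= 0 ->
  upper lam sig (slozi lam sig x) =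
  sig * (upper lam sig x - 2 * ((1 - sig) * (lam - sig) * x.1)).
Proof. by move=> x0; rewrite /upper /slozi /lozi /= ler0_norm //; ring. Qed.

Lemma lower_lozi_left (R : realType) (lam sig : R) x : x.1 <= 0 ->
  lower lam sig (slozi lam sig x) = lam * sig * upper lam sig x.
Proof.
by move=> x0; rewrite /upper /lower /slozi /lozi /= ler0_norm //; ring.
Qed.

Lemma lower_lozi_right (R : realType) (lam sig : R) x : 0 <= x.1 ->
  lower lam sig (slozi lam sig x) =
  lam * sig * (upper lam sig x + 2 * ((1 - sig) * (lam - sig) * x.1)).
Proof.
by move=> x0; rewrite /upper /lower /slozi /lozi /= ger0_norm //; ring.
Qed.

Lemma right_of_stable_lozi (R : realType) (lam sig : R) x : 0 <= x.1 ->
  right_of_stable lam (slozi lam sig x) = - lam * right_of_stable lam x.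
Proof.
by move=> x0; rewrite /right_of_stable /slozi /lozi /= ger0_norm //; ring.
Qed.

Lemma escape_lozi_left (R : realType) (lam sig : R) x : x.1 <= 0 ->
  escape lam (slozi lam sig x) = lam * escape lam x.
Proof. by move=> x0; rewrite /escape /slozi /lozi /= ler0_norm //; ring. Qed.

(** The lines [upper = 0] and [lower = 0] meet at [Z], which has abscissa
    [1 / (1 - sig)]; the wedge that they bound lies on its left. *)
Lemma wedge_le (R : realType) (lam sig : R) x : saddle_multipliers lam sig ->
  0 <= upper lam sig x -> 0 <= lower lam sig x -> (1 - sig) * x.1 <= 1.
Proof.
case=> s0 s1 l0 l2 _ _ _ _ u0 w0.
have : 0 <= (lam - 2 * sig) * upper lam sig x + lower lam sig x.
  by rewrite addr_ge0 // mulr_ge0 //; lra.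
have -> : (lam - 2 * sig) * upper lam sig x + lower lam sig x =
  (2 * sig * (lam - sig)) * (1 - (1 - sig) * x.1).
  by rewrite /upper /lower; ring.
by rewrite pmulr_rge0 ?subr_ge0 //; nra.
Qed.

(** On the wedge in [x_1 >= 0] the worst point is [Z].  The value of [escape] at
    its image is [lam * (2 - lam) * (lam - sig) / (1 - sig)], which is where
    [lam < 2] matters. *)
Lemma escape_lozi_right (R : realType) (lam sig : R) x :
  saddle_multipliers lam sig -> 0 <= x.1 ->
  0 <= upper lam sig x -> 0 <= lower lam sig x ->
  2 - lam <= escape lam (slozi lam sig x).
Proof.
move=> H x0 u0 w0; have e0 := wedge_le H u0 w0.
case: H => s0 s1 l0 l2 _ h _ _.
have D0 : 0 < (1 - sig) * (lam - 2 * sig) by nra.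
rewrite -(ler_pM2l D0).
have -> : (1 - sig) * (lam - 2 * sig) * escape lam (slozi lam sig x) =
  lam * ((lam - 1) * (lower lam sig x
     + (1 - (1 - sig) * x.1) * ((lam - 2 * sig) ^+ 2 - lam * sig))
     + (lam - 2 * sig) * (2 - lam) * (lam - sig)).
  by rewrite /escape /lower /slozi /lozi /= ger0_norm //; ring.
have k0 : 0 <= (1 - (1 - sig) * x.1) * ((lam - 2 * sig) ^+ 2 - lam * sig).
  by apply: mulr_ge0; nra.
apply: (@le_trans _ _ (lam * ((lam - 2 * sig) * (2 - lam) * (lam - sig)))).
  have : 0 <= (lam - 2 * sig) * (2 - lam) by apply: mulr_ge0; lra.
  set q := _ * (2 - lam) => q0.
  have -> : (1 - sig) * (lam - 2 * sig) * (2 - lam) = (1 - sig) * q by rewrite /q; ring.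
  have : 1 - sig <= lam * (lam - sig) by nra.
  by move=> /(ler_wpM2r q0) /le_trans; apply; rewrite le_eqVlt; apply/orP; left; apply/eqP; ring.
apply: ler_wpM2l; first by lra.
rewrite lerDr mulr_ge0 //; first by lra.
exact: addr_ge0.
Qed.

Lemma trap_invariant (R : realType) (lam sig : R) x :
  saddle_multipliers lam sig ->
  trap lam sig x -> trap lam sig (slozi lam sig x).
Proof.
move=> H [u0 w0 t0]; case: (H) => s0 s1 l0 l2 _ _ _ _.
have [x0|/ltW x0] := leP 0 x.1; split.
- by rewrite upper_lozi_right // mulr_ge0 // ltW.
- rewrite lower_lozi_right // mulr_ge0 //; first by nra.
  by rewrite addr_ge0 // !mulr_ge0 //; lra.
- exact: escape_lozi_right.
- rewrite upper_lozi_left // mulr_ge0 ?(ltW s0) //.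
  have : 0 <= (1 - sig) * (lam - sig) by apply: mulr_ge0; lra.
  by nra.
- by rewrite lower_lozi_left // mulr_ge0 //; nra.
- by rewrite escape_lozi_left //; nra.
Qed.

Lemma escape_trap_le (R : realType) (lam sig : R) x :
  saddle_multipliers lam sig -> trap lam sig x -> escape lam x <= 8.
Proof.
move=> H [u0 w0 t0]; have e0 := wedge_le H u0 w0.
case: H => s0 s1 l0 l2 _ _ _ _.
have x2 : x.1 <= 3 / 2 by nra.
have y2 : sig * x.1 + x.2 <= 1 / 2.
  by move: u0; rewrite /upper; move: (sig * x.1 + x.2) => v u0; nra.
have y3 : (lam - sig) * x.1 <= 3 by nra.
have : x.2 + lam * x.1 <= 4 by lra.
by rewrite /escape; move: (x.2 + lam * x.1) => v v4; nra.
Qed.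

Lemma core_bounds (R : realType) (lam sig : R) x :
  saddle_multipliers lam sig -> core lam sig x ->
  [/\ 0 < x.1, x.1 <= 3 / 2 & -1 <= x.2 <= 1].
Proof.
move=> H [u0 w0 r0]; have e0 := wedge_le H u0 w0.
case: H => s0 s1 l0 l2 d0 d1 g3 _.
have x32 : x.1 <= 3 / 2 by nra.
have x0 : 0 < x.1.
  have D0 : 0 < (1 - sig) * (lam - 2 * sig) by nra.
  have : 0 <= (1 - sig) * (lam - 2 * sig) * right_of_stable lam x
     + (1 + lam) * lower lam sig x by rewrite addr_ge0 // mulr_ge0 //; lra.
  have -> : (1 - sig) * (lam - 2 * sig) * right_of_stable lam x
     + (1 + lam) * lower lam sig x =
     lam * (((1 + lam) * (1 - sig) * (lam - 3 * sig)) * x.1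
            - (lam * (1 - 2 * sig) - sig * (3 - 2 * sig))).
    by rewrite /right_of_stable /lower; ring.
  rewrite pmulr_rge0; last by lra.
  have k0 : 0 < (1 + lam) * (1 - sig) * (lam - 3 * sig).
    by rewrite !mulr_gt0 //; lra.
  rewrite subr_ge0 => /(lt_le_trans _) K.
  by rewrite -(pmulr_rgt0 _ k0) K // subr_gt0.
split=> //; apply/andP; split.
  have : (1 - sig) * (lam - 2 * sig) * -1 <= (1 - sig) * (lam - 2 * sig) * x.2.
    move: w0; rewrite /lower.
    have : 0 < (1 - sig) * x.1 by rewrite mulr_gt0 //; lra.
    nra.
  by rewrite ler_pM2l //; nra.
by move: u0; rewrite /upper; nra.
Qed.

Lemma base_arc_trap (R : realType) (lam sig tau : R) :
  saddle_multipliers lam sig -> 0 <= tau <= 1 ->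
  trap lam sig (base_arc lam sig tau).
Proof.
case=> s0 s1 l0 l2 _ _ _ _ /andP[t0 t1].
have s1n : 1 - sig != 0 by lra.
split.
- rewrite (_ : upper _ _ _ = 0) // /upper /base_arc /=; field; lra.
- rewrite (_ : lower _ _ _ = 2 * (lam * sig * tau * (lam - sig))).
    rewrite !mulr_ge0 //; lra.
  rewrite /lower /base_arc /=; field; lra.
- have D0 : 0 < 1 - sig by lra.
  rewrite -(ler_pM2l D0).
  rewrite (_ : _ * escape _ _ = lam * (lam - sig) * ((2 - lam) + (lam - 1) * (1 - tau))).
    have : 0 <= (lam - 1) * (1 - tau) by apply: mulr_ge0; lra.
    have : 1 <= lam * (lam - sig) by nra.
    move: (lam * (lam - sig)) (_ * (1 - tau)) => p q; nra.
  rewrite /escape /base_arc /=; field; lra.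
Qed.

Lemma mem_base_arc (R : realType) (lam sig : R) y :
  saddle_multipliers lam sig -> upper lam sig y = 0 ->
  1 - lam <= (1 - sig) * y.1 <= 1 ->
  exists2 tau, 0 <= tau <= 1 & y = base_arc lam sig tau.
Proof.
case: y => y1 y2 [s0 s1 l0 l2 _ _ _ _]; rewrite /upper /= => u0 /andP[y1l y1u].
exists ((1 - (1 - sig) * y1) / lam).
  by rewrite divr_ge0 ?ler_pdivrMr; lra.
rewrite /base_arc; congr pair; first by field; lra.
have -> : y2 = (sig - (1 - sig) * sig * y1) / (1 - sig).
  have s1n : 1 - sig != 0 by lra.
  by apply: (mulfI s1n); rewrite mulrCA divff // mulr1; lra.
by field; lra.
Qed.

(** The preimage of a point of the segment lies in the right half of the segment,
    and it is closer to the saddle by the factor [1 / lam]. *)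
Lemma base_arc_sub_image (R : realType) (lam sig tau : R) :
  saddle_multipliers lam sig -> 0 <= tau <= 1 ->
  0 <= (1 - tau) / lam <= 1 /\
  base_arc lam sig tau = slozi lam sig (base_arc lam sig ((1 - tau) / lam)).
Proof.
move=> [s0 s1 l0 l2 _ _ _ _] /andP[t0 t1]; split.
  by rewrite divr_ge0 ?ler_pdivrMr; lra.
rewrite /base_arc /slozi /lozi /= ger0_norm.
  by congr pair; field; lra.
by rewrite divfK ?divr_ge0; lra.
Qed.

Lemma core_upper_edge (R : realType) (lam sig : R) y :
  saddle_multipliers lam sig -> core lam sig y -> upper lam sig y = 0 ->
  exists2 tau, 0 <= tau <= 1 & y = slozi lam sig (base_arc lam sig tau).
Proof.
move=> H yc u0; have [y0 _ _] := core_bounds H yc.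
case: yc => u1 w1 _; have e0 := wedge_le H u1 w1.
have [|tau t01 ->] := mem_base_arc H u0.
  rewrite e0 andbT; case: H => s0 s1 l0 _ _ _ _ _.
  by rewrite (@le_trans _ _ 0) ?mulr_ge0 //; lra.
have [t01' ->] := base_arc_sub_image H t01.
by eexists; [exact: t01' |].
Qed.

(** The preimage of the lower edge lies on the left half of the unstable line.
    It does not extend beyond [base_arc] because the end point of [base_arc] is
    mapped to the left of the stable line, by [fold_past_stable]. *)
Lemma core_lower_edge (R : realType) (lam sig : R) y :
  saddle_multipliers lam sig -> core lam sig y -> lower lam sig y = 0 ->
  exists2 tau, 0 <= tau <= 1 & y = slozi lam sig (base_arc lam sig tau).
Proof.
move=> H [u0 w1 r0] w0; have e0 := wedge_le H u0 w1.
case: H => s0 s1 l0 l2 _ _ _ g4.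
case: y u0 w0 w1 r0 e0 => y1 y2; rewrite /right_of_stable /lower /= => u0 w0 w1 r0 e0.
have ls0 : 0 < lam * sig by nra.
(* [Y] measures the depth below the axis; [Y = lam - 1] is the point where
   the image of [base_arc] ends. *)
have [Y HY] : exists Y, Y = - ((1 - sig) * y2) / (lam * sig) by eexists.
have Ey2 : y2 = - (Y * (lam * sig)) / (1 - sig).
  by rewrite HY; field; apply/andP; split; last apply/andP; try split; lra.
have Ey1 : y1 = (1 - (lam - 2 * sig) * Y) / (1 - sig).
  have s1n : 1 - sig != 0 by lra.
  have s2n : lam * sig != 0 by lra.
  apply: (mulfI s1n); rewrite mulrCA divff // mulr1.
  apply: (mulfI s2n); move: w0; rewrite Ey2.
  move/eqP; rewrite subr_eq0 => /eqP w0.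
  have -> : lam * sig * ((1 - sig) * y1) = lam * sig * ((1 - sig) * y1 - 1) + lam * sig by ring.
  by rewrite -w0; field.
have Y0 : 0 <= Y.
  have : 0 <= (lam - 2 * sig) * Y by move: e0; rewrite Ey1 mulrCA divff ?mulr1; lra.
  by rewrite pmulr_rge0 //; lra.
have Y1 : Y <= lam - 1.
  have : 0 <= (1 - sig) * ((1 + lam) * (lam * y1 - y2) - lam) by apply: mulr_ge0; lra.
  have -> : (1 - sig) * ((1 + lam) * (lam * y1 - y2) - lam) =
     lam * ((lam + sig) - (1 + lam) * (lam - 3 * sig) * Y).
    by rewrite Ey1 Ey2; field; lra.
  rewrite pmulr_rge0; last by lra.
  rewrite subr_ge0 => h.
  have k0 : 0 < (1 + lam) * (lam - 3 * sig) by apply: mulr_gt0; lra.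
  rewrite -(ler_pM2l k0) (le_trans h) //; nra.
exists ((1 + Y) / lam); first by rewrite divr_ge0 ?ler_pdivrMr; lra.
rewrite /slozi /lozi /base_arc /= Ey1 Ey2 ler0_norm.
  by congr pair; field; lra.
rewrite divfK; last by lra.
by rewrite pmulr_lle0 ?invr_gt0; lra.
Qed.

(** * Expansion of the inverse map *)

Definition lozi_inv (R : realType) (lam sig : R) (y : R * R) : R * R :=
  (y.2 / (lam * sig), y.1 - 1 + (lam - sig) * `|y.2| / (lam * sig)).

Lemma lozi_invK (R : realType) (lam sig : R) : 0 < lam * sig ->
  cancel (lozi_inv lam sig) (slozi lam sig).
Proof.
move=> b0 [y1 y2]; rewrite /slozi /lozi /lozi_inv /= normrM normfV (gtr0_norm b0).
have bn : lam * sig != 0 by rewrite gt_eqF.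
by congr pair; last first; [rewrite mulrC divfK|rewrite mulrA; ring].
Qed.

Lemma slozi_invK (R : realType) (lam sig : R) : 0 < lam * sig ->
  cancel (slozi lam sig) (lozi_inv lam sig).
Proof.
move=> b0 [x1 x2]; rewrite /slozi /lozi /lozi_inv /= normrM (gtr0_norm b0).
have bn : lam * sig != 0 by rewrite gt_eqF.
congr pair; first by rewrite mulrC mulKf.
by field; apply/andP; split; apply/eqP => h; move: bn; rewrite h ?mul0r ?mulr0 eqxx.
Qed.

Definition lerp (R : realType) (A B : R * R) (t : R) : R * R :=
  (A.1 + t * (B.1 - A.1), A.2 + t * (B.2 - A.2)).

(** The inverse map folds along [x_2 = 0], and is affine on each side. *)
Lemma lozi_inv_lerp (R : realType) (lam sig : R) (A B : R * R) t :
  0 <= A.2 * B.2 -> 0 <= t <= 1 ->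
  lozi_inv lam sig (lerp A B t) = lerp (lozi_inv lam sig A) (lozi_inv lam sig B) t.
Proof.
case: A B => [A1 A2] [B1 B2] /= AB /andP[t0 t1].
have E : `|A2 + t * (B2 - A2)| = `|A2| + t * (`|B2| - `|A2|).
  have -> : A2 + t * (B2 - A2) = (1 - t) * A2 + t * B2 by ring.
  have t1' : 0 <= 1 - t by lra.
  have [A0|A0] := leP 0 A2; have [B0|B0] := leP 0 B2.
  - rewrite (ger0_norm A0) (ger0_norm B0) ger0_norm; first by ring.
    by rewrite addr_ge0 // mulr_ge0.
  - have -> : A2 = 0 by nra.
    by rewrite normr0 mulr0 !add0r subr0 normrM (ger0_norm t0).
  - have -> : B2 = 0 by nra.
    by rewrite normr0 mulr0 addr0 sub0r normrM (ger0_norm t1'); ring.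
  - rewrite (ltr0_norm A0) (ltr0_norm B0) ler0_norm; first by ring.
    by rewrite -oppr_ge0 opprD -!mulrN addr_ge0 // mulr_ge0 // oppr_ge0 ltW.
by rewrite /lozi_inv /lerp /= E; congr pair; ring.
Qed.

(** One half of a segment lies on one side of [x_2 = 0], so that the fold of the
    inverse map costs at most a factor 2. *)
Lemma half_segment (R : realType) (A B : R * R) :
  exists P Q : R * R, [/\ 0 <= P.2 * Q.2,
    `|Q.1 - P.1| = `|B.1 - A.1| / 2, `|Q.2 - P.2| = `|B.2 - A.2| / 2 &
    forall t, 0 <= t <= 1 -> exists2 t', 0 <= t' <= 1 & lerp P Q t = lerp A B t'].
Proof.
have H2 : 0 <= 2^-1 :> R by rewrite invr_ge0.
have nB (x y : R) : x = y / 2 -> `|x| = `|y| / 2.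
  by move=> ->; rewrite normrM (ger0_norm H2).
have nC (x y : R) : x = (- y) / 2 -> `|x| = `|y| / 2.
  by move=> ->; rewrite normrM normrN (ger0_norm H2).
pose M := lerp A B 2^-1.
have [c|c] := leP 0 ((A.2 + B.2) * (B.2 - A.2)).
- exists M, B; split; rewrite /M /lerp /=.
  + rewrite (_ : _ * B.2 = ((A.2 + B.2) ^+ 2 + (A.2 + B.2) * (B.2 - A.2)) / 4);
      last by field.
    by rewrite divr_ge0 // addr_ge0 ?sqr_ge0.
  + by apply: nB; field.
  + by apply: nB; field.
  + move=> t t01; exists ((1 + t) / 2); first by lra.
    by congr pair; field.
- exists M, A; split; rewrite /M /lerp /=.
  + rewrite (_ : _ * A.2 = ((A.2 + B.2) ^+ 2 - (A.2 + B.2) * (B.2 - A.2)) / 4);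
      last by field.
    by rewrite divr_ge0 // subr_ge0 (le_trans (ltW c)) ?sqr_ge0.
  + by apply: nC; field.
  + by apply: nC; field.
  + move=> t t01; exists ((1 - t) / 2); first by lra.
    by congr pair; field.
Qed.

(** The linear parts of the inverse map send [v] to [(v_2 / b, v_1 +/- a * v_2 / b)].
    The cone [|v_1| <= |v_2|] is preserved since [1 + b <= a], and the second
    coordinate grows at least by the factor [a / b - 1 >= 7 / 3]. *)
Lemma lozi_inv_cone (R : realType) (lam sig : R) (A B : R * R) :
  saddle_multipliers lam sig -> 0 <= A.2 * B.2 -> `|B.1 - A.1| <= `|B.2 - A.2| ->
  let A' := lozi_inv lam sig A in let B' := lozi_inv lam sig B in
  `|B'.1 - A'.1| <= `|B'.2 - A'.2| /\
  7 / 3 * `|B.2 - A.2| <= `|B'.2 - A'.2|.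
Proof.
move=> [s0 s1 l0 l2 d0 d1 _ _] sgn cone /=.
have b0 : 0 < lam * sig by nra.
have [c Hc] : exists c, c = (lam * sig)^-1 by eexists.
have c0 : 0 < c by rewrite Hc invr_gt0.
have cb : lam * sig * c = 1 by rewrite Hc divff // gt_eqF.
rewrite -!Hc.
have -> : B.2 * c - A.2 * c = c * (B.2 - A.2) by ring.
have -> : B.1 - 1 + (lam - sig) * `|B.2| * c - (A.1 - 1 + (lam - sig) * `|A.2| * c)
  = (B.1 - A.1) + (lam - sig) * c * (`|B.2| - `|A.2|) by ring.
have E : `| `|B.2| - `|A.2| | = `|B.2 - A.2|.
  have [A0|A0] := leP 0 A.2; have [B0|B0] := leP 0 B.2.
  - by rewrite (ger0_norm A0) (ger0_norm B0).
  - have -> : A.2 = 0 by nra.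
    by rewrite normr0 !subr0 normr_id.
  - have -> : B.2 = 0 by nra.
    by rewrite normr0 !sub0r !normrN normr_id.
  - by rewrite (ltr0_norm A0) (ltr0_norm B0) -normrN; congr `|_|; ring.
have k0 : 0 <= (lam - sig) * c by apply: mulr_ge0; lra.
have K : (lam - sig) * c * `|B.2 - A.2| - `|B.2 - A.2|
    <= `|B.1 - A.1 + (lam - sig) * c * (`|B.2| - `|A.2|)|.
  have := ler_normB (B.1 - A.1 + (lam - sig) * c * (`|B.2| - `|A.2|)) (B.1 - A.1).
  have -> : B.1 - A.1 + (lam - sig) * c * (`|B.2| - `|A.2|) - (B.1 - A.1) =
     (lam - sig) * c * (`|B.2| - `|A.2|) by ring.
  by rewrite normrM (ger0_norm k0) E; lra.
rewrite normrM (gtr0_norm c0).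
have n0 := normr_ge0 (B.2 - A.2).
have e1 : c <= (lam - sig) * c - 1.
  have : c * (1 + lam * sig) <= c * (lam - sig) by rewrite ler_pM2l.
  by move: cb; lra.
have e2 : 10 / 3 <= (lam - sig) * c.
  have : c * (10 * (lam * sig)) <= c * (3 * (lam - sig)) by rewrite ler_pM2l.
  have -> : c * (10 * (lam * sig)) = 10 * (lam * sig * c) by ring.
  by rewrite cb; lra.
move: K; set x := `|B.1 - A.1 + _|; set d := `|B.2 - A.2| in n0 *.
move=> K; split; first by nra.
move: e2 K; move: ((lam - sig) * c) => k; nra.
Qed.

(** A factor [7 / 3] for the expansion, halved to keep one side of the fold only:
    each step gains [7 / 6]. *)
Lemma iter_lozi_inv_cone (R : realType) (lam sig : R) n (A B : R * R) :
  saddle_multipliers lam sig -> `|B.1 - A.1| <= `|B.2 - A.2| ->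
  (forall t, 0 <= t <= 1 -> `|(iter n (lozi_inv lam sig) (lerp A B t)).2| <= 1) ->
  (7 / 6) ^+ n * `|B.2 - A.2| <= 2.
Proof.
move=> H; elim: n A B => [|n IH] A B cone bnd.
  have := bnd 0; have := bnd 1; rewrite /lerp /= expr0.
  move=> /(_ _)/wrap[|b1]; first by lra.
  move=> /(_ _)/wrap[|b0]; first by lra.
  rewrite mul1r (_ : B.2 - A.2 = (A.2 + 1 * (B.2 - A.2)) - (A.2 + 0 * (B.2 - A.2))); last by ring.
  by apply: (le_trans (ler_normB _ _)); lra.
have [P [Q [sgn h1 h2 sub]]] := half_segment A B.
have [|c1 c2] := lozi_inv_cone H sgn; first by rewrite h1 h2; lra.
have {IH} := IH _ _ c1.
move=> /(_ _)/wrap[t t01|].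
  rewrite -lozi_inv_lerp // -iterSr; have [t' t01' ->] := sub _ t01.
  exact: bnd.
apply: le_trans; rewrite exprSr -mulrA ler_pM2l ?exprn_gt0 //.
by apply: le_trans c2; rewrite h2; lra.
Qed.

Lemma continuous_iter_lozi_inv (R : realType) (lam sig : R) n (p : R * R) :
  continuous (fun t : R => (iter n (lozi_inv lam sig) (p.1, p.2 + t)).1) /\
  continuous (fun t : R => (iter n (lozi_inv lam sig) (p.1, p.2 + t)).2).
Proof.
elim: n => [|n [c1 c2]] /=.
  split=> t; first exact: cvg_cst.
  by apply: cvgD; [exact: cvg_cst|exact: cvg_id].
split=> t; first by apply: cvgM; [exact: c2|exact: cvg_cst].
apply: cvgD; first by apply: cvgB; [exact: c1|exact: cvg_cst].
apply: cvgM; last exact: cvg_cst.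
by apply: cvgM; [exact: cvg_cst|apply: cvg_norm; exact: c2].
Qed.

Lemma iter_can (T : Type) (f g : T -> T) n : cancel f g -> cancel (iter n f) (iter n g).
Proof. by move=> fK; elim: n => // n IH x; rewrite iterSr /= fK IH. Qed.

(** Backward images of a vertical segment of length [e] outgrow [core], so that one
    of them crosses an edge of [core]; the intermediate value theorem for the
    minimum of the three affine forms provides the crossing point. *)
Lemma core_exit (R : realType) (lam sig : R) n (q : R * R) e :
  saddle_multipliers lam sig -> core lam sig q -> 2 < (7 / 6) ^+ n * e -> 0 < e ->
  exists y t, [/\ core lam sig y, 0 <= t <= e,
    iter n (slozi lam sig) y =
      ((iter n (slozi lam sig) q).1, (iter n (slozi lam sig) q).2 + t) &
    [\/ upper lam sig y = 0, lower lam sig y = 0 | right_of_stable lam y = 0]].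
Proof.
move=> H qc en e0.
have b0 : 0 < lam * sig by case: H => ? ? ? *; rewrite mulr_gt0 //; lra.
set p := iter n _ q.
pose gam t := iter n (lozi_inv lam sig) (p.1, p.2 + t).
have [c1 c2] := continuous_iter_lozi_inv lam sig n p.
have gamK t : iter n (slozi lam sig) (gam t) = (p.1, p.2 + t).
  exact: (iter_can n (lozi_invK b0)).
have gam0 : gam 0 = q.
  by rewrite /gam addr0 -surjective_pairing; exact: (iter_can n (slozi_invK b0)).
pose g t := Num.min (Num.min (upper lam sig (gam t)) (lower lam sig (gam t)))
                 (right_of_stable lam (gam t)).
have gE t : 0 <= g t <-> core lam sig (gam t).
  rewrite /g !le_min; split; first by move=> /andP[/andP[? ?] ?]; split.
  by move=> [-> -> ->].
have gc : continuous g.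
  have m (a b : R) : continuous (fun t => a * (gam t).1 + b * (gam t).2).
    by move=> t; apply: cvgD; (apply: cvgM; [exact: cvg_cst|]); [exact: c1|exact: c2].
  have cU : continuous (fun t => upper lam sig (gam t)).
    have -> : (fun t => upper lam sig (gam t)) = (fun t =>
        sig + ((- (1 - sig) * sig) * (gam t).1 + (- (1 - sig)) * (gam t).2)).
      by apply/funext => t; rewrite /upper; ring.
    by move=> t; apply: cvgD; [exact: cvg_cst|exact: m].
  have cL : continuous (fun t => lower lam sig (gam t)).
    have -> : (fun t => lower lam sig (gam t)) = (fun t =>
        lam * sig + ((- lam * sig * (1 - sig)) * (gam t).1 +
                     ((1 - sig) * (lam - 2 * sig)) * (gam t).2)).
      by apply/funext => t; rewrite /lower; ring.
    by move=> t; apply: cvgD; [exact: cvg_cst|exact: m].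
  have cS : continuous (fun t => right_of_stable lam (gam t)).
    have -> : (fun t => right_of_stable lam (gam t)) = (fun t =>
        - lam + (((1 + lam) * lam) * (gam t).1 + (- (1 + lam)) * (gam t).2)).
      by apply/funext => t; rewrite /right_of_stable; ring.
    by move=> t; apply: cvgD; [exact: cvg_cst|exact: m].
  move=> t; apply: (@continuous_min R R
    ((fun t => upper lam sig (gam t)) \min (fun t => lower lam sig (gam t)))
    (fun t => right_of_stable lam (gam t)) t); last exact: cS.
  by apply: continuous_min; [exact: cU|exact: cL].
(* Otherwise the whole segment would stay in [core], against the expansion. *)
have [t1 t1e ng1] : exists2 t1, 0 <= t1 <= e & g t1 < 0.
  apply: contrapT => /forall2NP hN.
  suff : (7 / 6) ^+ n * e <= 2 by lra.
  have := @iter_lozi_inv_cone _ lam sig n p (p.1, p.2 + e) H.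
  rewrite /= subrr normr0 addrAC subrr add0r (gtr0_norm e0); apply; first exact: ltW.
  move=> t t01; rewrite /lerp /= subrr mulr0 addr0 addrAC subrr add0r.
  have [|/negP] := hN (t * e); first by case; nra.
  rewrite -leNgt => /gE /(core_bounds H) [_ _] h.
  by rewrite ler_norml.
have [t1g0 t1le] := andP t1e.
have g0 : 0 <= g 0 by apply/gE; rewrite gam0.
have [||t] := @IVT R g 0 t1 0 t1g0.
- exact: continuous_subspaceT.
- by rewrite ge_min le_max g0 (ltW ng1) orbT.
rewrite in_itv /= => /andP[t0 tt1] gt0; exists (gam t), t; split.
- by apply/gE; rewrite gt0.
- by rewrite t0 (le_trans tt1).
- exact: gamK.
- move: gt0; rewrite /g.
  by rewrite /Order.min; case: ifP => _; [case: ifP => _ ?|]; constructor.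
Qed.

(** * Backward orbits are near the images of the base arc *)

Definition close (R : realType) (e : R) (x y : R * R) : Prop :=
  `|x.1 - y.1| <= e /\ `|x.2 - y.2| <= e.

Definition arc (R : realType) (lam sig : R) n (tau : R) : R * R :=
  iter n (slozi lam sig) (base_arc lam sig tau).

Definition saddle (R : realType) (lam sig : R) : R * R :=
  (((1 + lam) * (1 - sig))^-1, lam * sig / ((1 + lam) * (1 - sig))).

Lemma saddle_base_arc (R : realType) (lam sig : R) :
  saddle_multipliers lam sig ->
  0 <= (1 + lam)^-1 <= 1 /\ saddle lam sig = base_arc lam sig (1 + lam)^-1.
Proof.
move=> [s0 s1 l0 l2 _ _ _ _]; split.
  by rewrite invr_ge0 invf_le1; lra.
by rewrite /saddle /base_arc; congr pair; field; lra.
Qed.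

Lemma saddle_fixed (R : realType) (lam sig : R) :
  saddle_multipliers lam sig -> slozi lam sig (saddle lam sig) = saddle lam sig.
Proof.
move=> [s0 s1 l0 l2 _ _ _ _].
have D0 : 0 < ((1 + lam) * (1 - sig))^-1 by rewrite invr_gt0 mulr_gt0; lra.
rewrite /slozi /lozi /saddle /= gtr0_norm //.
by congr pair; field; lra.
Qed.

(** [base_arc] is contained in its image, so that its images increase. *)
Lemma arc_le (R : realType) (lam sig : R) m n tau :
  saddle_multipliers lam sig -> (m <= n)%N -> 0 <= tau <= 1 ->
  exists2 tau', 0 <= tau' <= 1 & arc lam sig m tau = arc lam sig n tau'.
Proof.
move=> H /subnK <-; elim: (n - m)%N tau => [|k IH] tau t01; first by exists tau.
have [tau' t01' ->] := IH _ t01.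
have [t01'' E] := base_arc_sub_image H t01'.
by exists ((1 - tau') / lam) => //; rewrite addSn /arc E iterSr.
Qed.

(** The stable segment between the saddle and a point of [x_1 >= 0] stays in the
    half plane where the map is affine with multiplier [sig]. *)
Lemma stable_edge_lozi (R : realType) (lam sig : R) y t :
  saddle_multipliers lam sig -> 0 <= y.1 -> right_of_stable lam y = 0 ->
  0 <= t <= 1 ->
  slozi lam sig (lerp (saddle lam sig) y t) = lerp (saddle lam sig) y (t * sig).
Proof.
move=> [s0 s1 l0 l2 _ _ _ _] y0 r0 /andP[t0 t1].
have Ey2 : y.2 = lam * y.1 - lam / (1 + lam).
  move: r0; rewrite /right_of_stable.
  have l1n : 1 + lam != 0 by lra.
  by move=> r0; apply: (mulfI l1n); rewrite mulrBr [X in _ = _ - X]mulrCA divff // mulr1; lra.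
rewrite /slozi /lozi ger0_norm; last first.
  rewrite /lerp /= (_ : _ + _ = (1 - t) * ((1 + lam) * (1 - sig))^-1 + t * y.1); last by ring.
  rewrite addr_ge0 // mulr_ge0 //; first by lra.
  by rewrite invr_ge0 mulr_ge0 //; lra.
by rewrite /lerp /saddle /= Ey2; congr pair; field; lra.
Qed.

Lemma stable_edge_iter (R : realType) (lam sig : R) y n :
  saddle_multipliers lam sig -> 0 <= y.1 -> right_of_stable lam y = 0 ->
  iter n (slozi lam sig) y = lerp (saddle lam sig) y (sig ^+ n).
Proof.
move=> H y0 r0; elim: n => [|n IH] /=.
  by rewrite expr0 /lerp !mul1r !subrKC; case: y {y0 r0}.
rewrite IH stable_edge_lozi // ?exprSr //.
case: H => s0 s1 _ _ _ _ _ _.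
by rewrite exprn_ge0 ?exprn_ile1 //; lra.
Qed.

(** Up to [e], a point of the [n]-th image of [core] is the [n]-th image of a point
    of an edge of [core].  The two unstable edges are contained in the image of
    [base_arc].  The [n]-th image of the stable edge is close to the saddle, which
    belongs to [base_arc]; the condition on [n] ensures this too, because
    [sig < 6 / 7]. *)
Lemma core_image_near_arc (R : realType) (lam sig : R) n q e :
  saddle_multipliers lam sig -> core lam sig q -> 0 < e -> 2 < (7 / 6) ^+ n * e ->
  exists2 tau, 0 <= tau <= 1 &
    close (2 * e) (iter n (slozi lam sig) q) (arc lam sig n.+1 tau).
Proof.
move=> H qc e0 en; have [y [t [yc /andP[t0 te] Ey hy]]] := core_exit H qc en e0.
have near_p z : close e (iter n (slozi lam sig) y) z ->
    close (2 * e) (iter n (slozi lam sig) q) z.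
  rewrite /close Ey /= => -[h1 h2]; split; first by lra.
  rewrite (_ : _ - z.2 = ((iter n (slozi lam sig) q).2 + t - z.2) - t); last by ring.
  by apply: (le_trans (ler_normB _ _)); rewrite (ger0_norm t0); lra.
have edge tau : 0 <= tau <= 1 -> y = slozi lam sig (base_arc lam sig tau) ->
    exists2 tau, 0 <= tau <= 1 &
      close (2 * e) (iter n (slozi lam sig) q) (arc lam sig n.+1 tau).
  move=> t01 yE; exists tau => //; apply: near_p.
  by rewrite /arc iterSr -yE /close !subrr normr0; split; exact: ltW.
case: hy => hy.
- have [tau t01 yE] := core_upper_edge H yc hy; exact: edge yE.
- have [tau t01 yE] := core_lower_edge H yc hy; exact: edge yE.
(* The stable edge: its image is within [2 * sig ^+ n] of the saddle. *)
have [y1 y2 /andP[y3 y4]] := core_bounds H yc.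
have [t01 XE] := saddle_base_arc H.
exists (1 + lam)^-1 => //; apply: near_p.
rewrite /arc -XE (iter_fix _ (saddle_fixed H)) (stable_edge_iter n H (ltW y1) hy).
case: H => s0 s1 l0 l2 _ _ _ _.
have X1 : 0 <= ((1 + lam) * (1 - sig))^-1 <= 1.
  rewrite invr_ge0 invf_le1 ?mulr_gt0 ?mulr_ge0; try lra.
  by rewrite mulrC; nra.
have X2 : 0 <= lam * sig / ((1 + lam) * (1 - sig)) <= 1.
  move: X1 => /andP[X1 X1']; have b0 : 0 <= lam * sig by nra.
  by rewrite mulr_ge0 //= mulr_ile1 //; nra.
have P0 : 0 < (7 / 6) ^+ n :> R by rewrite exprn_gt0 //; lra.
have Q0 : 0 <= sig ^+ n by rewrite exprn_ge0 // ltW.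
have PQ : (7 / 6) ^+ n * sig ^+ n <= 1 by rewrite -exprMn exprn_ile1 //; lra.
have S : sig ^+ n * 2 <= e by rewrite -(ler_pM2l P0); nra.
by rewrite /close /lerp /saddle /= ![_ + _ * _ - _]addrAC !subrr !add0r
  !normrM (ger0_norm Q0); split; apply: le_trans S; apply: ler_wpM2l => //;
  rewrite ler_norml; lra.
Qed.

(** A point of [trap] outside [core] with [x_1 >= 0] lies on the left of the stable
    line, and the negative multiplier [- lam] sends it to the right of that
    line, into [core].  An orbit that avoids [core] is therefore in the left
    half plane, where [escape] is multiplied by [lam]. *)
Lemma escape_growth (R : realType) (lam sig : R) (u : nat -> R * R) m K :
  saddle_multipliers lam sig -> (forall n, slozi lam sig (u n.+1) = u n) ->
  (forall n, trap lam sig (u n)) ->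
  (forall j, (m <= j <= m + K)%N -> ~ core lam sig (u j)) ->
  escape lam (u m) = lam ^+ K * escape lam (u (m + K)%N).
Proof.
move=> H uL uT; elim: K => [|K IH] nc; first by rewrite expr0 mul1r addn0.
rewrite IH; last by move=> j /andP[mj jK]; apply: nc; rewrite mj addnS leqW.
rewrite exprSr -mulrA addnS -(@escape_lozi_left _ lam sig) ?uL //.
have l0 : 0 < lam by case: H => _ _ ? *; lra.
rewrite leNgt; apply/negP => /ltW x0.
have /nc : (m <= m + K <= m + K.+1)%N by rewrite leq_addr leq_add2l leqnSn.
have /nc : (m <= (m + K).+1 <= m + K.+1)%N by rewrite -addnS leq_addr leqnn.
have [u1 w1 _] := uT (m + K)%N; have [u2 w2 _] := uT (m + K).+1.
move=> n2; apply; split=> //.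
rewrite -uL right_of_stable_lozi // mulNr -mulrN mulr_ge0 ?ltW // oppr_gt0 ltNge.
by apply/negP => r0; apply: n2; split.
Qed.

Lemma backward_orbit_visits_core (R : realType) (lam sig : R) (u : nat -> R * R) m K :
  saddle_multipliers lam sig -> (forall n, slozi lam sig (u n.+1) = u n) ->
  (forall n, trap lam sig (u n)) -> 8 < lam ^+ K * (2 - lam) ->
  exists2 j, (m <= j <= m + K)%N & core lam sig (u j).
Proof.
move=> H uL uT K8; apply: contrapT => /forall2NP hN.
have E : escape lam (u m) = lam ^+ K * escape lam (u (m + K)%N).
  by apply: (escape_growth H) => // j jm; case: (hN j).
have := escape_trap_le H (uT m); have [_ _ t0] := uT (m + K)%N.
rewrite E; apply/negP; rewrite -ltNge; apply: lt_le_trans K8 _.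
by apply: ler_wpM2l => //; rewrite exprn_ge0 //; case: H => _ _ ? *; lra.
Qed.

(** The index [n + K] works for all the backward orbits in [trap] at once. *)
Lemma backward_orbit_near_arc (R : realType) (lam sig : R) (u : nat -> R * R) n K e :
  saddle_multipliers lam sig -> (forall n, slozi lam sig (u n.+1) = u n) ->
  (forall n, trap lam sig (u n)) -> 8 < lam ^+ K * (2 - lam) ->
  0 < e -> 2 < (7 / 6) ^+ n * e ->
  exists2 tau, 0 <= tau <= 1 & close (2 * e) (u 0%N) (arc lam sig (n + K).+1 tau).
Proof.
move=> H uL uT K8 e0 en.
have [j /andP[nj jK] jc] := backward_orbit_visits_core n H uL uT K8.
have ej : 2 < (7 / 6) ^+ j * e.
  by apply: lt_le_trans en _; rewrite ler_pM2r // ler_weXn2l //; lra.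
have [tau t01] := core_image_near_arc H jc e0 ej.
have -> : iter j (slozi lam sig) (u j) = u 0%N.
  by elim: (j) => // k IH; rewrite iterSr uL.
have jN : (j.+1 <= (n + K).+1)%N by rewrite ltnS.
by have [tau' t01' ->] := arc_le H jN t01; exists tau'.
Qed.

(** * The saddle and its unstable manifold *)

Lemma cvg_plane (R : realType) (T : Type) (F : set_system T) (f g : T -> R) (l m : R) :
  Filter F -> f @ F --> l -> g @ F --> m ->
  (fun t => (f t, g t)) @ F --> ((l, m) : R * R).
Proof. by move=> FF fl gm; exact: (cvg_pair (G := nbhs l) (H := nbhs m) fl gm). Qed.

Lemma exists_expr_gt (R : realType) (q M : R) : 1 < q -> exists n, M < q ^+ n.
Proof.
move=> q1; have bern n : 1 + (q - 1) * n%:R <= q ^+ n.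
  elim: n => [|n IH]; first by rewrite mulr0 addr0 expr0.
  have n0 : 0 <= (q - 1) * ((q - 1) * n%:R) by rewrite !mulr_ge0 //; lra.
  by rewrite exprS -natr1; nra.
exists (Num.bound (M / (q - 1))); apply: lt_le_trans (bern _).
have /archi_boundP : 0 <= `|M / (q - 1)| by [].
have := ler_norm (M / (q - 1)); move=> /le_lt_trans /[apply].
rewrite /Num.bound normr_id ltr_pdivrMr; last by lra.
by rewrite mulrC; lra.
Qed.

(** The differential of the map in the right half plane. *)
Definition lozi_linear (R : realType) (a b : R) (v : R * R) : R * R :=
  (- a * v.1 + v.2, b * v.1).

Lemma scale_selfE (R : realType) (u v : R) : u *: (v : R^o) = u * v.
Proof. by []. Qed.

Fact lozi_linear_is_linear (R : realType) (a b : R) : linear (@lozi_linear R a b).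
Proof.
move=> k [x1 x2] [y1 y2]; rewrite /lozi_linear /=.
by congr pair => /=; rewrite !scale_selfE; ring.
Qed.

HB.instance Definition _ (R : realType) (a b : R) :=
  GRing.isLinear.Build R (R * R)%type (R * R)%type _ (@lozi_linear R a b)
    (@lozi_linear_is_linear R a b).

Lemma lozi_linear_continuous (R : realType) (a b : R) : continuous (@lozi_linear R a b).
Proof.
have h1 : continuous (fun v : R * R => v.1) by move=> v; exact: cvg_fst.
have h2 : continuous (fun v : R * R => v.2) by move=> v; exact: cvg_snd.
move=> v; apply: cvg_plane.
  by apply: cvgD; [apply: cvgM; [exact: cvg_cst|exact: h1]|exact: h2].
by apply: cvgM; [exact: cvg_cst|exact: h1].
Qed.

Lemma lozi_diff_right (R : realType) (a b : R) (x : R * R) : 0 < x.1 ->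
  differentiable (lozi (a, b)) x /\
  'd (lozi (a, b)) x = lozi_linear a b :> (R * R -> R * R).
Proof.
move=> x0.
pose V : normedModType R := (R * R)%type.
have E : (lozi (a, b) : V -> V) \o shift (x : V) = cst (lozi (a, b) x : V) + (lozi_linear a b : V -> V) +o_ (0 : V) id.
  apply/eqaddoP => _/posnumP[e]; near=> h.
  rewrite (_ : (_ - _) h = 0); first by rewrite normr0 mulr_ge0.
  apply/eqP; rewrite /= subr_eq0; apply/eqP; rewrite /lozi /lozi_linear /=.
  have hx : 0 < h.1 + x.1.
    near: h; apply/nbhs_ballP; exists x.1 => //= h [/= h1 _].
    by move: h1; rewrite /ball /= sub0r normrN ltr_norml; lra.
  rewrite !fctE /= !gtr0_norm //; congr pair => /=; ring.
have D := diff_unique (@lozi_linear_continuous R a b) E.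
split=> //; apply/diff_locallyP; rewrite D; split=> //.
exact: lozi_linear_continuous.
Unshelve. all: by end_near. Qed.

Lemma saddle_is_saddle (R : realType) (lam sig : R) :
  saddle_multipliers lam sig ->
  saddle_fixed_point (slozi lam sig) (saddle lam sig) /\ 0 < (saddle lam sig).1.
Proof.
move=> H; have [s0 s1 l0 l2 _ _ _ _] := H.
have D0 : 0 < (saddle lam sig).1 by rewrite invr_gt0 mulr_gt0; lra.
have [d1 d2] := lozi_diff_right (lam - sig) (lam * sig) D0.
split=> //; split; [exact: saddle_fixed|by []|].
have b0 : lam * sig != 0 by rewrite mulf_neq0; lra.
exists sig, (- lam); split.
- exists (sig, lam * sig); first by rewrite xpair_eqE /= negb_and b0 orbT.
  by rewrite d2 /lozi_linear /=; congr pair => /=; rewrite scale_selfE; ring.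
- exists (- lam, lam * sig); first by rewrite xpair_eqE /= negb_and b0 orbT.
  by rewrite d2 /lozi_linear /=; congr pair => /=; rewrite scale_selfE; ring.
- by rewrite normrN !gtr0_norm; lra.
Qed.

Lemma lozi_saddleE (R : realType) (lam sig : R) : saddle_multipliers lam sig ->
  lozi_saddle (lam - sig, lam * sig) = saddle lam sig.
Proof.
move=> H; rewrite /lozi_saddle.
have := @getPex _ [set X : R * R | saddle_fixed_point (lozi (lam - sig, lam * sig)) X /\ 0 < X.1]
  (ex_intro _ _ (saddle_is_saddle H)).
set X := get _ => -[[XE _ _] X0]; move: X0 XE; case: X => X1 X2 /= X0.
rewrite /lozi /= gtr0_norm // => -[E1 E2].
have [s0 s1 l0 l2 _ _ _ _] := H.
have D0 : (1 + lam) * (1 - sig) != 0 by rewrite mulf_neq0; lra.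
have EX : X1 = ((1 + lam) * (1 - sig))^-1.
  by apply: (mulIf D0); rewrite mulVf //; nra.
by rewrite /saddle -EX -E2 EX.
Qed.

(** Near the saddle the map is affine and [upper] is contracted by [sig]; on a
    backward orbit that stays near the saddle, [upper] is bounded, and so it
    vanishes.  The orbit thus starts on the unstable line, inside [trap], and it
    remains in [trap]. *)
Lemma unstable_backward_orbit_trap (R : realType) (lam sig : R) (u : nat -> R * R) :
  saddle_multipliers lam sig -> (forall n, slozi lam sig (u n.+1) = u n) ->
  u @ \oo --> saddle lam sig -> forall n, trap lam sig (u n).
Proof.
move=> H uL cu; have [s0 s1 l0 l2 _ _ _ _] := H.
have D0 : 0 < ((1 + lam) * (1 - sig))^-1 by rewrite invr_gt0 mulr_gt0; lra.
have D1 : ((1 + lam) * (1 - sig))^-1 * ((1 + lam) * (1 - sig)) = 1.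
  by rewrite mulVf // mulf_neq0; lra.
have [N _ uN] : \forall n \near \oo, ball (saddle lam sig) ((saddle lam sig).1 / 2) (u n).
  by apply: cvg_ball => //; rewrite divr_gt0.
have {uN} uN n : (N <= n)%N -> [/\ 0 < (u n).1, (1 - sig) * (u n).1 < 1 & `|(u n).2| <= 2].
  move=> /uN [/= h1 h2]; move: h1 h2; rewrite /ball /=; move: D0 D1.
  set c := _^-1 => D0 D1; rewrite !ltr_norml => /andP[h1 h1'] /andP[h2 h2'].
  have c1 : (1 - sig) * c <= 5 / 12 by nra.
  have c2 : c <= 1 by nra.
  have c3 : 0 <= lam * sig * c <= 1 by nra.
  split; [lra|nra|rewrite ler_norml; lra].
have up0 n : (N <= n)%N -> upper lam sig (u n) = 0.
  move=> Nn; have up k : upper lam sig (u n) = sig ^+ k * upper lam sig (u (n + k)%N).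
    elim: k => [|k ->]; first by rewrite addn0 expr0 mul1r.
    rewrite exprSr -mulrA addnS -upper_lozi_right ?uL //.
    by have [|/ltW] := uN (n + k).+1; first by rewrite leqW // (leq_trans Nn) ?leq_addr.
  have upb k : `|upper lam sig (u (n + k)%N)| <= 4.
    have [|x0 x1 y] := uN (n + k)%N; first by rewrite (leq_trans Nn) ?leq_addr.
    by move: y; rewrite /upper !ler_norml => /andP[y1 y2]; apply/andP; split; nra.
  (* A nonzero value would exceed the bound 4 after division by [sig ^+ k],
     as [sig < 1 / 2]. *)
  apply/eqP; rewrite -normr_le0 leNgt; apply/negP => p0.
  have [k] := @exists_expr_gt R 2 (4 / `|upper lam sig (u n)|) ltac:(lra).
  rewrite ltr_pdivrMr // => K.
  have : sig ^+ k * 2 ^+ k <= 1 by rewrite -exprMn exprn_ile1; lra.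
  have sk : 0 <= sig ^+ k by rewrite exprn_ge0 // ltW.
  move=> sk2; have := upb k; move: K; rewrite {1}(up k) normrM (ger0_norm sk).
  have := normr_ge0 (upper lam sig (u (n + k)%N)); set q := `|_| => q0.
  have : (sig ^+ k * 2 ^+ k) * q <= q by rewrite ler_piMl.
  by lra.
have tN n : (N <= n)%N -> trap lam sig (u n).
  move=> Nn; have [x0 x1 _] := uN n Nn; have E := up0 n Nn.
  split; first by rewrite E.
    rewrite (_ : lower _ _ _ = (2 * sig * (lam - sig)) * (1 - (1 - sig) * (u n).1)
      - (lam - 2 * sig) * upper lam sig (u n)).
      by rewrite E mulr0 subr0 mulr_ge0 //; nra.
    by rewrite /upper /lower; ring.
  have D : 0 < 1 - sig by lra.
  rewrite -(ler_pM2l D) (_ : _ * escape _ _ = (1 - sig) * lam + (lam - 1) *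
     (sig + (1 - sig) * (lam - sig) * (u n).1 - upper lam sig (u n))).
    rewrite E subr0; have : 0 <= (1 - sig) * (lam - sig) * (u n).1.
      by rewrite !mulr_ge0 //; lra.
    by nra.
  by rewrite /upper /escape; ring.
move=> n; have : trap lam sig (u (n + N)%N) by apply: tN; rewrite leq_addl.
elim: N {uN up0 tN} => [|k IH]; first by rewrite addn0.
by rewrite addnS => /(trap_invariant H); rewrite uL.
Qed.

Lemma unstable_manifold_image (R : realType) (f : R * R -> R * R) X x :
  unstable_manifold f X x -> unstable_manifold f X (f x).
Proof.
move=> [u [u0 uf uX]].
exists (fun n => if n is m.+1 then u m else f x); split=> //.
  by case=> [|n]; rewrite ?u0.
by move=> A /uX [N _ uA]; exists N.+1 => // -[|n] //= Nn; exact: uA.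
Qed.

(** The preimages of a point chosen in [base_arc] have parameters that obey
    [t -> (1 - t) / lam], a contraction with fixed point [1 / (1 + lam)], the
    parameter of the saddle. *)
Lemma arc_sub_unstable (R : realType) (lam sig : R) n tau :
  saddle_multipliers lam sig -> 0 <= tau <= 1 ->
  unstable_manifold (slozi lam sig) (saddle lam sig) (arc lam sig n tau).
Proof.
move=> H t01; elim: n => [|n IH]; last exact: unstable_manifold_image.
have [s0 s1 l0 l2 _ _ _ _] := H.
pose t n := (1 + lam)^-1 + (- lam^-1) ^+ n * (tau - (1 + lam)^-1).
have tS k : t k.+1 = (1 - t k) / lam.
  by rewrite /t exprS; field; lra.
have tb k : 0 <= t k <= 1.
  elim: k => [|k IH]; first by rewrite /t expr0 mul1r subrKC.
  by rewrite tS; have [] := base_arc_sub_image H IH.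
exists (fun n => base_arc lam sig (t n)); split.
- by rewrite /t expr0 mul1r subrKC.
- by move=> k; rewrite tS; have [_ <-] := base_arc_sub_image H (tb k).
have ct : t @ \oo --> (1 + lam)^-1.
  rewrite -[X in _ --> X]addr0 -[X in _ + X](mul0r (tau - (1 + lam)^-1)).
  apply: cvgD; first exact: cvg_cst.
  apply: cvgM; last exact: cvg_cst.
  by apply: cvg_expr; rewrite normrN gtr0_norm ?invr_gt0 ?invf_lt1; lra.
have [_ ->] := saddle_base_arc H.
rewrite /base_arc; apply: cvg_plane.
  apply: cvgM; last exact: cvg_cst.
  by apply: cvgB; [exact: cvg_cst|apply: cvgM; [exact: ct|exact: cvg_cst]].
by do 2 (apply: cvgM; last exact: cvg_cst).
Qed.

(** * Dependence on the parameters and Hausdorff distance *)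

Lemma closeC (R : realType) (e : R) x y : close e x y -> close e y x.
Proof. by rewrite /close distrC [`|x.2 - _|]distrC. Qed.

Lemma close_trans (R : realType) (e f : R) x y z :
  close e x y -> close f y z -> close (e + f) x z.
Proof.
move=> [h1 h2] [k1 k2]; split.
  by apply: le_trans (ler_distD y.1 _ _) _; exact: lerD.
by apply: le_trans (ler_distD y.2 _ _) _; exact: lerD.
Qed.

(** [sig] is the positive root of [X ^ 2 + a * X - b]; subtract the two equations. *)
Lemma sig_lipschitz (R : realType) (lam sig lam' sig' d : R) :
  saddle_multipliers lam sig -> saddle_multipliers lam' sig' ->
  `|(lam - sig) - (lam' - sig')| <= d -> `|lam * sig - lam' * sig'| <= d ->
  `|sig - sig'| <= 2 * d.
Proof.
move=> [s0 s1 l0 _ _ _ _ _] [s0' s1' l0' _ _ _ _ _].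
move=> ha hb; have d0 : 0 <= d := le_trans (normr_ge0 _) ha.
have E : (sig - sig') * (lam + sig') =
    (lam * sig - lam' * sig') - sig' * ((lam - sig) - (lam' - sig')) by ring.
have K : `|sig - sig'| * (lam + sig') <= 2 * d.
  have k0 : 0 < lam + sig' by lra.
  rewrite -{1}(gtr0_norm k0) -normrM E (le_trans (ler_normB _ _)) //.
  by rewrite normrM (gtr0_norm s0'); have := normr_ge0 (lam - sig - (lam' - sig')); nra.
apply: le_trans K; rewrite ler_peMr //; lra.
Qed.

Lemma quotient_lipschitz (R : realType) (x x' sig sig' d : R) :
  0 < sig < 3 / 10 -> 0 < sig' < 3 / 10 -> `|x'| <= 1 ->
  `|x - x'| <= 3 * d -> `|sig - sig'| <= 2 * d ->
  `|x / (1 - sig) - x' / (1 - sig')| <= 11 * d.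
Proof.
move=> /andP[s0 s1] /andP[s0' s1'] x1 hx hs.
have D0 : 0 < (1 - sig) * (1 - sig') by apply: mulr_gt0; lra.
have -> : x / (1 - sig) - x' / (1 - sig') =
    ((x - x') * (1 - sig') + x' * (sig - sig')) / ((1 - sig) * (1 - sig')).
  by field; lra.
rewrite normrM normfV (gtr0_norm D0) ler_pdivrMr //.
apply: (le_trans (ler_normD _ _)); rewrite !normrM (gtr0_norm (_ : 0 < 1 - sig')); last lra.
have h1 : `|x - x'| * (1 - sig') <= 3 * d.
  by apply: le_trans hx; rewrite ler_piMr //; lra.
have h2 : `|x'| * `|sig - sig'| <= 2 * d by apply: le_trans hs; rewrite ler_piMl.
have d0 : 0 <= d by have := normr_ge0 (x - x'); lra.
have : 49 / 100 <= (1 - sig) * (1 - sig') by nra.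
by move: D0; set D := (1 - sig) * _ => D0 D49; nra.
Qed.

(** The abscissa is bounded uniformly in the parameters, so that the dependence of
    the map on its parameters is uniformly Lipschitz on [trap]. *)
Lemma trap_abscissa (R : realType) (lam sig : R) x :
  saddle_multipliers lam sig -> trap lam sig x -> `|x.1| <= 4.
Proof.
move=> H [u0 w0 t0]; have e0 := wedge_le H u0 w0.
case: H => s0 s1 l0 l2 _ _ _ _.
have x32 : x.1 <= 3 / 2 by nra.
have y2 : sig * x.1 + x.2 <= 1 / 2.
  by move: u0; rewrite /upper; move: (sig * x.1 + x.2) => v u0; nra.
have y3 : -2 <= x.2 + lam * x.1.
  by move: t0; rewrite /escape; move: (x.2 + lam * x.1) => v t0; nra.
have y4 : - (5 / 2) <= (lam - sig) * x.1 by lra.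
have D : 11 / 10 < lam - sig by lra.
rewrite ler_norml; apply/andP; split; last by lra.
by rewrite leNgt; apply/negP => xn; nra.
Qed.

Lemma lozi_close (R : realType) (a b a' b' d e : R) x y :
  0 <= a <= 2 -> 0 <= b <= 1 -> `|a - a'| <= d -> `|b - b'| <= d ->
  `|y.1| <= 4 -> close e x y ->
  close (3 * e + 4 * d) (lozi (a, b) x) (lozi (a', b') y).
Proof.
move=> /andP[a0 a2] /andP[b0 b1] ha hb y4 [h1 h2]; rewrite /lozi /=.
have e0 : 0 <= e := le_trans (normr_ge0 _) h1.
have d0 : 0 <= d := le_trans (normr_ge0 _) ha.
have hn := le_trans (ler_dist_dist x.1 y.1) h1.
split => /=.
  rewrite (_ : _ - _ = (x.2 - y.2) - a * (`|x.1| - `|y.1|) - (a - a') * `|y.1|); last by ring.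
  apply: (le_trans (ler_normB _ _)); rewrite normrM normr_id.
  have k2 : `|a - a'| * `|y.1| <= d * 4 by apply: ler_pM.
  have k1 : `|x.2 - y.2 - a * (`|x.1| - `|y.1|)| <= e + 2 * e.
    apply: (le_trans (ler_normB _ _)); rewrite normrM (ger0_norm a0).
    by apply: lerD => //; apply: ler_pM.
  by lra.
rewrite (_ : _ - _ = b * (x.1 - y.1) + (b - b') * y.1); last by ring.
apply: (le_trans (ler_normD _ _)); rewrite !normrM (ger0_norm b0).
have k2 : `|b - b'| * `|y.1| <= d * 4 by apply: ler_pM.
have k1 : b * `|x.1 - y.1| <= 1 * e by apply: ler_pM.
by lra.
Qed.

Lemma arc_lipschitz (R : realType) n : exists2 C : R, 0 < C &
  forall lam sig lam' sig' tau d : R,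
    saddle_multipliers lam sig -> saddle_multipliers lam' sig' ->
    `|(lam - sig) - (lam' - sig')| <= d -> `|lam * sig - lam' * sig'| <= d ->
    0 <= tau <= 1 -> close (C * d) (arc lam sig n tau) (arc lam' sig' n tau).
Proof.
elim: n => [|n [C C0 IH]].
  exists 11 => // lam sig lam' sig' tau d H H' ha hb /andP[t0 t1].
  have hs := sig_lipschitz H H' ha hb.
  have [s0 s1 l0 l2 _ _ _ _] := H; have [s0' s1' l0' l2' _ _ _ _] := H'.
  have d0 : 0 <= d := le_trans (normr_ge0 _) ha.
  have b' : 0 <= lam' * sig' <= 1 by apply/andP; split; nra.
  split => /=; apply: quotient_lipschitz => //; try by apply/andP.
  - by rewrite ler_norml; apply/andP; split; nra.
  - rewrite (_ : _ - _ = tau * (- ((lam - sig) - (lam' - sig')) - (sig - sig'))); last by ring.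
    rewrite normrM (ger0_norm t0) (@le_trans _ _ (1 * (3 * d))) ?mul1r //.
    rewrite -[X in _ <= X]mul1r; apply: ler_pM => //.
    by apply: (le_trans (ler_normB _ _)); rewrite normrN; lra.
  - by rewrite ler_norml; apply/andP; split; nra.
  - rewrite -mulrBr normrM (ger0_norm t0) (@le_trans _ _ (1 * d)) //; last by lra.
    by apply: ler_pM.
exists (3 * C + 4); first by lra.
move=> lam sig lam' sig' tau d H H' ha hb t01.
have [s0 s1 l0 l2 _ _ _ _] := H.
have -> : (3 * C + 4) * d = 3 * (C * d) + 4 * d by ring.
apply: lozi_close => //; try by apply/andP; split; nra.
  apply: (trap_abscissa H'); rewrite -/(arc _ _ _ _).
  elim: n {IH} => [|n IHn]; first exact: base_arc_trap.
  exact: trap_invariant.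
exact: IH.
Qed.

(** A fixed image of [base_arc] approximates the whole unstable manifold, with an
    index that is uniform as long as [lam] stays away from 2. *)
Lemma unstable_near_arc (R : realType) (c e : R) : 0 < c -> 0 < e ->
  exists N, forall lam sig p, saddle_multipliers lam sig -> c <= 2 - lam ->
    unstable_manifold (slozi lam sig) (saddle lam sig) p ->
    exists2 tau, 0 <= tau <= 1 & close e p (arc lam sig N tau).
Proof.
move=> c0 e0.
have [K HK] := @exists_expr_gt R (7 / 5) (8 / c) ltac:(lra).
have [n Hn] := @exists_expr_gt R (7 / 6) (4 / e) ltac:(lra).
exists (n + K).+1 => lam sig p H cl [u [<- uL uX]].
have -> : e = 2 * (e / 2) by field.
apply: backward_orbit_near_arc => //.
- exact: unstable_backward_orbit_trap.
- move: HK; rewrite ltr_pdivrMr // => /lt_le_trans; apply.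
  have [_ _ l0 _ _ _ _ _] := H.
  apply: ler_pM (ltW c0) _ cl; first by rewrite exprn_ge0 //; lra.
  by apply: lerXn2r; rewrite ?nnegrE; lra.
- by lra.
- by move: Hn; rewrite ltr_pdivrMr //; lra.
Qed.

Lemma closure_close (R : realType) (A : set (R * R)) e p : 0 < e -> closure A p ->
  exists2 q, A q & close e p q.
Proof.
move=> e0 /(_ (ball p e)) []; first exact: nbhsx_ballx.
by move=> q [Aq [/ltW h1 /ltW h2]]; exists q.
Qed.

Lemma euclid_dist_close (R : realType) (e : R) x y : close e x y ->
  euclid_dist x y <= 2 * e.
Proof.
move=> [h1 h2]; have e0 : 0 <= e := le_trans (normr_ge0 _) h1.
have k0 : 0 <= 2 * e by lra.
rewrite /euclid_dist -[leRHS](ger0_norm k0) -sqrtr_sqr ler_wsqrtr //.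
by rewrite -[(x.1 - _) ^+ 2]real_normK ?num_real // -[(x.2 - _) ^+ 2]real_normK ?num_real //;
  have := normr_ge0 (x.1 - y.1); have := normr_ge0 (x.2 - y.2); nra.
Qed.

Lemma close_euclid_dist (R : realType) (d : R) x y : euclid_dist x y < d -> close d x y.
Proof.
rewrite /euclid_dist => /ltW h; split; apply: le_trans h;
  by rewrite -sqrtr_sqr ler_wsqrtr // ?lerDl ?lerDr sqr_ge0.
Qed.

Lemma asym_dist_le (R : realType) (A B : set (R * R)) (e : R) :
  (forall x, A x -> exists2 y, B y & close e x y) ->
  (asym_dist A B <= (2 * e)%:E)%E.
Proof.
move=> AB; apply: ge_ereal_sup => _ [x /AB [y By xy] <-].
apply: (@le_trans _ _ (euclid_dist x y)%:E); first by apply: ereal_inf_lbound; exists y.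
by rewrite lee_fin euclid_dist_close.
Qed.

Theorem theorem7p2 (R : realType) (mu : R * R) (hmu : lozi_params mu) :
  hausdorff_continuous_at (@lozi_params R) (@lozi_attractor R) mu.
Proof.
case: mu hmu => a b hmu e e0.
(* [4 - 2 * a - b = (2 - lam) * (2 + sig)], so that the distance of [lam] to 2 is
   controlled by the parameters. *)
have gap (lam sig : R) : saddle_multipliers lam sig ->
    4 - 2 * (lam - sig) - lam * sig <= 3 * (2 - lam).
  by case=> *; nra.
have g0 : 0 < 4 - 2 * a - b by case: hmu => _ /andP[_ h] _ _; lra.
have [lam [sig [H Ea Eb]]] := lozi_params_multipliers hmu.
have c0 : 0 < (4 - 2 * a - b) / 6 by lra.
have e1 : 0 < e / 16 by lra.
have [N HN] := unstable_near_arc c0 e1.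
have [C C0 HC] := arc_lipschitz R N.
(* The roles of the two parameters are symmetric: both satisfy the bound on
   [2 - l], so that the same index [N] serves both. *)
have one_sided (l s l' s' d : R) : saddle_multipliers l s -> saddle_multipliers l' s' ->
    (4 - 2 * a - b) / 6 <= 2 - l -> C * d <= e / 16 ->
    `|(l - s) - (l' - s')| <= d -> `|l * s - l' * s'| <= d ->
    (asym_dist (lozi_attractor (l - s, l * s)%R) (lozi_attractor (l' - s', l' * s')%R)
      <= (2 * (e / 16 + e / 16 + e / 16))%:E)%E.
  move=> Hl Hl' cl Cd ha hb; apply: asym_dist_le => x.
  rewrite /lozi_attractor !lozi_saddleE // => /(closure_close e1) [q qW xq].
  have [tau t01 qtau] := HN _ _ _ Hl cl qW.
  have [k1 k2] := HC _ _ _ _ _ _ Hl Hl' ha hb t01.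
  exists (arc l' s' N tau).
    by apply: subset_closure; exact: arc_sub_unstable.
  apply: close_trans (close_trans xq qtau) _.
  by split; [exact: le_trans k1 Cd|exact: le_trans k2 Cd].
exists (Num.min ((4 - 2 * a - b) / 6) (e / 16 / C)).
  by rewrite lt_min c0 divr_gt0.
case=> a' b' hnu /close_euclid_dist.
have [lam' [sig' [H' Ea' Eb']]] := lozi_params_multipliers hnu.
set d := Num.min _ _ => -[/= ha hb].
have d1 : d <= (4 - 2 * a - b) / 6 by rewrite ge_min lexx.
have d2 : C * d <= e / 16 by rewrite mulrC -ler_pdivlMr // ge_min lexx orbT.
have cl : (4 - 2 * a - b) / 6 <= 2 - lam.
  by have := gap _ _ H; rewrite -Ea -Eb; lra.
have cl' : (4 - 2 * a - b) / 6 <= 2 - lam'.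
  have := gap _ _ H'; rewrite -Ea' -Eb'.
  by move: ha hb; rewrite !ler_norml; lra.
move: ha hb; rewrite Ea Eb Ea' Eb' => ha hb.
apply: (@le_lt_trans _ _ (2 * (e / 16 + e / 16 + e / 16))%:E); last by rewrite lte_fin; lra.
rewrite /hausdorff_dist ge_max; apply/andP; split.
  exact: (one_sided _ _ _ _ d).
by apply: (one_sided _ _ _ _ d); rewrite // distrC.
Qed.
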